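(* Let $\mathfrak g_{d}$ be an $n$-dyon and $\mathfrak g_{t}$ an $n$-triadon on the same $n$-dimensional vector space $V$. Let $C_{d},C_{t}$ be their centers, $\Delta=[\mathfrak g_{d},\mathfrak g_{d}]$ the derived algebra of the dyon, $C_{12}=C_{d}\cap C_{t}$ and $C=C_{d}+C_{t}$. If $\dim C_{12}=n-3$ and $\Delta\subset C$, then $\mathfrak g_{d}$ and $\mathfrak g_{t}$ are compatible.
   Context: The ground field $\mathbf k$ has characteristic zero. An $n$-dyon is a Lie algebra structure on an $n$-dimensional vector space isomorphic to the direct sum of the non-abelian $2$-dimensional Lie algebra and the $(n-2)$-dimensional abelian Lie algebra. An $n$-triadon is one isomorphic to the direct sum of the $3$-dimensional Heisenberg algebra ($[\varepsilon_1,\varepsilon_2]=\varepsilon_3$, $\varepsilon_3$ central) and the $(n-3)$-dimensional abelian Lie algebra. Two Lie algebra structures on $V$ are compatible if the sum of their brackets is a Lie bracket. *)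

(* Defs.v *)
From HB Require Import structures.
From mathcomp Require Import all_boot all_order all_algebra.
From mathcomp Require Import ring.

Set Implicit Arguments.
Unset Strict Implicit.
Unset Printing Implicit Defensive.

Import GRing.Theory.
Local Open Scope ring_scope.

Definition is_lie_bracket (k : fieldType) (V : lmodType k) (b : V -> V -> V) :
  Prop :=
  [/\ forall x, linear (b x),
      forall y, linear (b^~ y),
      forall x, b x x = 0
    & forall x y z, b x (b y z) + b y (b z x) + b z (b x y) = 0].

Record lie_structure (k : fieldType) (V : lmodType k) := LieStructure {
  lie_bracket :> V -> V -> V;
  lie_bracketP : is_lie_bracket lie_bracket
}.

Section LieStructures.
Variable k : fieldType.

Definition compatible (V : lmodType k) (g h : lie_structure V) : Prop :=
  is_lie_bracket (fun x y => g x y + h x y).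

Definition lie_abelian (V : lmodType k) (g : lie_structure V) : Prop :=
  forall x y, g x y = 0.

Definition lie_isomorphic (V W : lmodType k)
    (g : lie_structure V) (h : lie_structure W) : Prop :=
  exists f : {linear V -> W},
    bijective f /\ forall x y, f (g x y) = h (f x) (f y).

Lemma abelian_bracketP (V : lmodType k) :
  is_lie_bracket (fun _ _ : V => 0 : V).
Proof. by split=> [x a y z|y a x z|x|x y z]; rewrite ?scaler0 ?addr0. Qed.

Definition abelian_lie (V : lmodType k) : lie_structure V :=
  LieStructure (abelian_bracketP V).

Lemma dsum_bracketP (V W : lmodType k)
    (g : lie_structure V) (h : lie_structure W) :
  is_lie_bracket (fun x y : V * W => (g x.1 y.1, h x.2 y.2)).
Proof.
case: (lie_bracketP g) => gr gl ga gj; case: (lie_bracketP h) => hr hl ha hj.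
split=> [x a y z|z a x y|x|x y z].
- by apply/eqP; rewrite xpair_eqE gr hr /= !eqxx.
- have := gl z.1 a x.1 y.1; have := hl z.2 a x.2 y.2 => /= Eh Eg.
  by apply/eqP; rewrite xpair_eqE /= Eg Eh !eqxx.
- by rewrite ga ha.
- by apply/eqP; rewrite xpair_eqE /= gj hj !eqxx.
Qed.

Definition lie_dsum (V W : lmodType k)
    (g : lie_structure V) (h : lie_structure W) :
    lie_structure (V * W)%type :=
  LieStructure (dsum_bracketP g h).

(* The coordinates 0, 1, 2 : 'I_3 are those on e1, e2, e3. *)
Definition heisenberg_bracket (x y : 'rV[k]_3) : 'rV[k]_3 :=
  (x 0 0 * y 0 1 - x 0 1 * y 0 0) *: delta_mx 0 2.

Lemma heisenberg_bracketP : is_lie_bracket heisenberg_bracket.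
Proof.
rewrite /heisenberg_bracket; split=> [x a y z|z a x y|x|x y z] /=.
- by rewrite scalerA -scalerDl !mxE; congr (_ *: _); ring.
- by rewrite scalerA -scalerDl !mxE; congr (_ *: _); ring.
- by rewrite mulrC subrr scale0r.
- by rewrite !mxE /= !mulr0 !subrr !scale0r !addr0.
Qed.

Definition heisenberg_lie : lie_structure 'rV[k]_3 :=
  LieStructure heisenberg_bracketP.

Lemma heisenberg_e1e2 :
  heisenberg_lie (delta_mx 0 0) (delta_mx 0 1) = delta_mx 0 2.
Proof. by rewrite /= /heisenberg_bracket !mxE /= mulr1 mulr0 subr0 scale1r. Qed.

Lemma heisenberg_e3 x : heisenberg_lie (delta_mx 0 2) x = 0.
Proof. by rewrite /= /heisenberg_bracket !mxE /= !mul0r subrr scale0r. Qed.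

Section FiniteDimensional.
Variable V : vectType k.
Implicit Type g : lie_structure V.

(* The truncated n - 2 is harmless: the isomorphism forces 2 <= n. *)
Definition is_dyon (n : nat) g : Prop :=
  \dim {:V} = n /\
  exists a : lie_structure 'rV[k]_2,
    ~ lie_abelian a /\
    lie_isomorphic g (lie_dsum a (abelian_lie 'rV[k]_(n - 2))).

(* The truncated n - 3 is harmless: the isomorphism forces 3 <= n. *)
Definition is_triadon (n : nat) g : Prop :=
  \dim {:V} = n /\
  lie_isomorphic g (lie_dsum heisenberg_lie (abelian_lie 'rV[k]_(n - 3))).

(* The kernel of the adjoint representation V -> End(V). *)
Definition lie_center g : {vspace V} := lker (linfun (fun x => linfun (g x))).

(* By bilinearity, brackets of basis vectors span all brackets
   (lie_derivedP). *)
Definition lie_derived g : {vspace V} :=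
  <<[seq g x y | x <- vbasis {:V}, y <- vbasis {:V}]>>%VS.

Lemma lie_centerP g x :
  reflect (forall y, g x y = 0) (x \in lie_center g).
Proof.
case: (lie_bracketP g) => gr gl _ _.
have adE z w : linfun (g z) w = g z w.
  pose L := GRing.isLinear.Build _ _ _ _ (g z) (gr z).
  pose f : {linear V -> V} := HB.pack (g z : V -> V) L.
  exact: (lfunE f).
have adL : linear (fun x => linfun (g x)).
  move=> a u v; apply/lfunP=> w.
  by rewrite add_lfunE scale_lfunE !adE; exact: gl.
pose L := GRing.isLinear.Build _ _ _ _ (fun x => linfun (g x)) adL.
pose f : {linear V -> 'Hom(V, V)} := HB.pack (fun x => linfun (g x)) L.
rewrite memv_ker (lfunE f) /=.
apply: (iffP eqP) => [E y|E]; first by rewrite -adE E zero_lfunE.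
by apply/lfunP=> y; rewrite adE zero_lfunE.
Qed.

Lemma lie_derivedP g (U : {vspace V}) :
  reflect (forall x y, g x y \in U) (lie_derived g <= U)%VS.
Proof.
case: (lie_bracketP g) => gr gl _ _.
apply: (iffP span_subvP) => [H x y|H _ /allpairsP[[x y] [_ _ ->]] //].
pose Lx := GRing.isLinear.Build _ _ _ _ (g x) (gr x).
pose fx : {linear V -> V} := HB.pack (g x : V -> V) Lx.
rewrite -[g x y]/(fx y) (coord_vbasis (memvf y)) linear_sum; apply: memv_suml => i _.
rewrite linearZ; apply: memvZ => /=.
set z := (vbasis _)`_i.
pose Lz := GRing.isLinear.Build _ _ _ _ (g^~ z) (gl z).
pose fz : {linear V -> V} := HB.pack ((g^~ z) : V -> V) Lz.
rewrite -[g x z]/(fz x) (coord_vbasis (memvf x)) linear_sum; apply: memv_suml => j _.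
rewrite linearZ; apply: memvZ => /=.
by apply: H; apply: allpairs_f; rewrite mem_nth // size_tuple.
Qed.

End FiniteDimensional.
End LieStructures.

(* Main.v *)
Require Import Defs.
From mathcomp Require Import all_boot all_order all_algebra.
From mathcomp Require Import zify.
Import GRing.Theory.
Local Open Scope ring_scope.

Set Implicit Arguments.
Unset Strict Implicit.
Unset Printing Implicit Defensive.

(** Two Lie algebras sharing an abelian ideal [C] of codimension one are
    compatible.  Indeed, if [e] spans a complement of [C], each of the brackets
    is determined by the endomorphism [ad e] of [C]; the sum of the brackets is
    determined in the same way by the sum of the two endomorphisms, and any
    endomorphism of [C] defines a Lie bracket, that of the semidirect product
    of a line with the abelian algebra [C] ([jacobi_abelian_hyperplane]).

    Here [C] is the sum of the two centers.  Both centers have codimension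
    exactly 2: they contain the kernel of a linear map to a plane, and a Lie
    algebra with a center of codimension at most one is abelian
    ([lie_center_codim]).  As the centers meet in dimension [n - 3], their sum
    has dimension [n - 1], and each center is spanned by the intersection and
    one further vector; hence each bracket vanishes on the center of the other,
    and so on [C] ([lie_abelian_center_sum]).  Finally [C] is an ideal: it
    contains the derived algebra of the dyon by hypothesis, and that of the
    triadon because the Heisenberg algebra is nilpotent of class 2. *)

(** * Subspaces of codimension at most one *)

Lemma subv_add_line (k : fieldType) (V : vectType k) (U W : {vspace V}) :
  (\dim W <= (\dim U).+1)%N -> (U <= W)%VS ->
  exists2 e, e \in W & (W <= U + <[e]>)%VS.
Proof.
move=> dimW sUW; have [sWU|] := boolP (W <= U)%VS.
  by exists 0; rewrite ?mem0v // (subv_trans sWU) ?addvSl.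
case/subvPn=> e eW eNU; exists e => //.
have sUeW : (U + <[e]> <= W)%VS by rewrite subv_add sUW -memvE.
suff dimUe : (\dim U < \dim (U + <[e]>))%N.
  have /eqP<- : (U + <[e]> == W)%VS; last by [].
  by rewrite eqEdim sUeW (leq_trans dimW).
rewrite ltn_neqAle dimvS ?addvSl // andbT; apply: contra eNU => /eqP dimE.
have /eqP-> : U == (U + <[e]>)%VS by rewrite eqEdim addvSl dimE /=.
by rewrite memvE addvSr.
Qed.

Lemma mem_add_lineP (k : fieldType) (V : vectType k) (U W : {vspace V})
    (e x : V) :
  (W <= U + <[e]>)%VS -> x \in W ->
  exists2 c, c \in U & exists a, x = c + a *: e.
Proof.
move=> sW /(subvP sW) /memv_addP[c cU [_ /vlineP[a ->] ->]].
by exists c => //; exists a.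
Qed.

Lemma dim_lker_ge (k : fieldType) (V W : vectType k) (f : 'Hom(V, W)) :
  (\dim {:V} - \dim {:W} <= \dim (lker f))%N.
Proof.
have := limg_ker_dim f fullv; rewrite capfv => <-.
by rewrite leq_subLR [leqRHS]addnC leq_add2l dimvS ?subvf.
Qed.

(** * Alternating bilinear brackets *)

Section AlternatingBracket.
Variables (k : fieldType) (V : lmodType k) (b : V -> V -> V).
Hypotheses (b_linr : forall x, linear (b x)) (b_linl : forall y, linear (b^~ y)).
Hypothesis b_alt : forall x, b x x = 0.

Lemma bracketDr x y z : b x (y + z) = b x y + b x z.
Proof. by have := b_linr x 1 y z; rewrite !scale1r. Qed.

Lemma bracketDl x y z : b (x + y) z = b x z + b y z.
Proof. by have := b_linl z 1 x y; rewrite /= !scale1r. Qed.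

Lemma bracketx0 x : b x 0 = 0.
Proof. by apply: (addrI (b x 0)); rewrite -bracketDr !addr0. Qed.

Lemma bracket0x x : b 0 x = 0.
Proof. by apply: (addrI (b 0 x)); rewrite -bracketDl !addr0. Qed.

Lemma bracketZr x a y : b x (a *: y) = a *: b x y.
Proof. by have := b_linr x a y 0; rewrite bracketx0 !addr0. Qed.

Lemma bracketZl x a y : b (a *: x) y = a *: b x y.
Proof. by have := b_linl y a x 0; rewrite /= bracket0x !addr0. Qed.

Lemma bracketC x y : b x y = - b y x.
Proof.
apply/eqP; rewrite -addr_eq0; apply/eqP.
have := b_alt (x + y); rewrite bracketDr !bracketDl !b_alt add0r addr0.
by rewrite addrC.
Qed.

End AlternatingBracket.

(** With [ci] the component of the i-th argument in [C] and [ai] its coordinate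
    on [e], the double bracket [b x (b y z)] is [a1 a2 T c3 - a1 a3 T c2] where
    [T] is the square of [b e]; these terms cancel in the cyclic sum. *)
Lemma jacobi_abelian_hyperplane (k : fieldType) (V : vectType k)
    (b : V -> V -> V) (C : {vspace V}) :
  (forall x, linear (b x)) -> (forall y, linear (b^~ y)) ->
  (forall x, b x x = 0) ->
  (\dim {:V} <= (\dim C).+1)%N ->
  (forall x y, b x y \in C) ->
  (forall x y, x \in C -> y \in C -> b x y = 0) ->
  is_lie_bracket b.
Proof.
move=> br bl ba dimC bC b0; split=> // x y z.
have [e _ sV] := subv_add_line dimC (subvf C).
have dec v := mem_add_lineP sV (memvf v).
have bre c a c' a' : c \in C -> c' \in C ->
  b (c + a *: e) (c' + a' *: e) = a *: b e c' - a' *: b e c.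
  move=> cC c'C; rewrite (bracketDr br) !(bracketDl bl).
  rewrite !(bracketZr br) !(bracketZl bl) ba b0 // !scaler0 addr0.
  by rewrite add0r (bracketC br bl ba c) scalerN.
have brC c a c' : c \in C -> c' \in C -> b (c + a *: e) c' = a *: b e c'.
  by move=> cC c'C; rewrite (bracketDl bl) (bracketZl bl) b0 ?add0r.
have brB u v w : b u (v - w) = b u v - b u w.
  by rewrite -scaleN1r (bracketDr br) (bracketZr br) scaleN1r.
case: (dec x) => c1 c1C [a1 ->]; case: (dec y) => c2 c2C [a2 ->].
case: (dec z) => c3 c3C [a3 ->].
rewrite !bre // !brC ?memvB ?memvZ //.
rewrite !brB !(bracketZr br) !scalerBr !scalerA.
rewrite (mulrC a2 a1) (mulrC a3 a1) (mulrC a3 a2).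
by rewrite [X in X + _]addrC !subrKA subrr.
Qed.

(** * Centers *)

Section Centers.
Variables (k : fieldType) (V : vectType k).
Implicit Types g h : lie_structure V.

Lemma lie_center_r g x y : y \in lie_center g -> g x y = 0.
Proof.
case: (lie_bracketP g) => gr gl ga _ /lie_centerP gy.
by rewrite (bracketC gr gl ga) gy oppr0.
Qed.

(** Modulo the central part [U], any two vectors of [W] are proportional. *)
Lemma lie_abelian_add_line g (U W : {vspace V}) :
  (U <= lie_center g)%VS -> (U <= W)%VS -> (\dim W <= (\dim U).+1)%N ->
  {in W &, forall x y, g x y = 0}.
Proof.
case: (lie_bracketP g) => gr gl ga _ sUZ sUW dimW x y.
have [e _ sWe] := subv_add_line dimW sUW.
case/(mem_add_lineP sWe) => c /(subvP sUZ) cZ [a ->].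
case/(mem_add_lineP sWe) => d /(subvP sUZ) dZ [a' ->].
rewrite (bracketDl gl) (lie_centerP _ _ cZ) add0r (bracketDr gr).
rewrite lie_center_r // add0r (bracketZl gl) (bracketZr gr) ga.
by rewrite !scaler0.
Qed.

Lemma lie_center_codim g :
  ~ lie_abelian g -> (\dim (lie_center g) + 2 <= \dim {:V})%N.
Proof.
move=> gN; rewrite addn2 ltnNge; apply/negP=> dimZ; case: gN => x y.
by apply: (lie_abelian_add_line (subvv _) (subvf _) dimZ); exact: memvf.
Qed.

(** On the sum of the two centers, [g] only sees the center of [h], in which
    the intersection is central for [g] and of codimension at most one. *)
Lemma lie_abelian_center_sum g h :
  (\dim (lie_center h) <= (\dim (lie_center g :&: lie_center h)).+1)%N ->
  {in (lie_center g + lie_center h)%VS &, forall x y, g x y = 0}.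
Proof.
case: (lie_bracketP g) => gr gl _ _ dimZ x y.
case/memv_addP=> u uZ [u' u'Z ->]; case/memv_addP=> v vZ [v' v'Z ->].
rewrite (bracketDl gl) (lie_centerP _ _ uZ) add0r (bracketDr gr).
rewrite lie_center_r // add0r.
by apply: (lie_abelian_add_line (capvSl _ _) (capvSr _ _) dimZ).
Qed.

Lemma lie_center_iso (W : lmodType k) g (h : lie_structure W)
    (f : {linear V -> W}) x :
  injective f -> (forall x y, f (g x y) = h (f x) (f y)) ->
  (forall w, h (f x) w = 0) -> x \in lie_center g.
Proof.
move=> f_inj fM hx; apply/lie_centerP=> y.
by apply: f_inj; rewrite fM hx linear0.
Qed.

Lemma lie_abelian_iso (W : lmodType k) g (h : lie_structure W) :
  lie_isomorphic g h -> lie_abelian g -> lie_abelian h.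
Proof.
case=> f [[f' fK f'K] fM] gA x y.
by rewrite -[x]f'K -[y]f'K -fM gA linear0.
Qed.

(** * Dyons and triadons *)

Lemma dyon_center_dim n g : is_dyon n g -> (\dim (lie_center g) + 2 = n)%N.
Proof.
case=> dimV [a [aN iso]]; apply/eqP; rewrite eqn_leq; apply/andP; split.
  rewrite -dimV; apply: lie_center_codim => /(lie_abelian_iso iso) sA.
  by apply: aN => x y; have [] := sA (x, 0) (y, 0).
case: iso => f [/bij_inj f_inj fM].
pose p := linfun (fst \o f).
have kerZ : (lker p <= lie_center g)%VS.
  apply/subvP=> x; rewrite memv_ker lfunE /= => /eqP fx.
  apply: (lie_center_iso f_inj fM) => w /=.
  by case: (lie_bracketP a) => _ al _ _; rewrite fx (bracket0x al).
have := dim_lker_ge p; rewrite dimV dimvf /dim /= leq_subLR addnC.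
by move/leq_trans; apply; rewrite leq_add2r dimvS.
Qed.

(** This makes the truncated [n - 3], the dimension of the intersection of the
    centers, a true difference. *)
Lemma triadon_dim_ge n g : is_triadon n g -> (3 <= n)%N.
Proof.
case=> dimV [f [[f' _ f'K] _]]; pose p := linfun (fst \o f).
have <- : \dim (limg p) = 3%N; last first.
  by rewrite -dimV -(limg_ker_dim p fullv) leq_addl.
suff -> : limg p = fullv by rewrite dimvf.
apply/eqP; rewrite eqEsubv subvf; apply/subvP=> w _.
by apply/memv_imgP; exists (f' (w, 0)); rewrite ?memvf // lfunE /= f'K.
Qed.

Lemma triadon_center_dim n g :
  is_triadon n g -> (\dim (lie_center g) + 2 = n)%N.
Proof.
case=> dimV iso; apply/eqP; rewrite eqn_leq; apply/andP; split.
  rewrite -dimV; apply: lie_center_codim => /(lie_abelian_iso iso) sA.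
  have [] := sA (delta_mx 0 0, 0) (delta_mx 0 1, 0).
  have := heisenberg_e1e2 k => /= -> /matrixP/(_ 0 2)/eqP.
  by rewrite !mxE /= oner_eq0.
case: iso => f [/bij_inj f_inj fM].
(* The Heisenberg bracket only depends on the first two coordinates. *)
pose p := linfun (@lsubmx k 1 2 1 \o (fst \o f)).
have kerZ : (lker p <= lie_center g)%VS.
  apply/subvP=> x; rewrite memv_ker lfunE /= => /eqP/rowP fx.
  apply: (lie_center_iso f_inj fM) => w /=.
  have /= := fx 0; have /= := fx 1; rewrite !mxE.
  have -> : lshift 1 (0 : 'I_2) = 0 by apply: val_inj.
  have -> : lshift 1 (1 : 'I_2) = 1 by apply: val_inj.
  by move=> e1 e0; rewrite /heisenberg_bracket e0 e1 !mul0r subrr scale0r.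
have := dim_lker_ge p; rewrite dimV dimvf /dim /= leq_subLR addnC.
by move/leq_trans; apply; rewrite leq_add2r dimvS.
Qed.

Lemma triadon_bracket_center n g x y : is_triadon n g -> g x y \in lie_center g.
Proof.
case=> _ [f [/bij_inj f_inj fM]].
apply: (lie_center_iso f_inj fM) => w.
by rewrite fM /= /heisenberg_bracket !mxE /= !mulr0 !mul0r subrr scale0r.
Qed.

End Centers.

Theorem lemma6p6 (k : fieldType) (k_char0 : [pchar k] =i pred0)
    (n : nat) (V : vectType k) (gd gt : lie_structure V)
    (gd_dyon : is_dyon n gd) (gt_triadon : is_triadon n gt)
    (dim_C12 : \dim (lie_center gd :&: lie_center gt) = (n - 3)%N)
    (derived_sub_C :
      (lie_derived gd <= lie_center gd + lie_center gt)%VS) :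
  compatible gd gt.
Proof.
have n_ge3 := triadon_dim_ge gt_triadon.
have dimD := dyon_center_dim gd_dyon.
have dimT := triadon_center_dim gt_triadon.
have dimV : \dim {:V} = n by case: gd_dyon.
have dimD' : \dim (lie_center gd) = (n - 3).+1 by lia.
have dimT' : \dim (lie_center gt) = (n - 3).+1 by lia.
have gdC : {in (lie_center gd + lie_center gt)%VS &, forall x y, gd x y = 0}.
  by apply: lie_abelian_center_sum; rewrite dim_C12 dimT'.
have gtC : {in (lie_center gd + lie_center gt)%VS &, forall x y, gt x y = 0}.
  by rewrite addvC; apply: lie_abelian_center_sum; rewrite capvC dim_C12 dimD'.
case: (lie_bracketP gd) => dr dl da _; case: (lie_bracketP gt) => tr tl ta _.
apply: (@jacobi_abelian_hyperplane _ _ _ (lie_center gd + lie_center gt)%VS).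
- by move=> x a y z; rewrite dr tr scalerDr addrACA.
- move=> y a x z; have /= -> := dl y a x z; have /= -> := tl y a x z.
  by rewrite scalerDr addrACA.
- by move=> x; rewrite da ta addr0.
- have := dimv_sum_cap (lie_center gd) (lie_center gt).
  rewrite dim_C12 dimD' dimT' dimV.
  by lia.
- move=> x y; apply: memvD; first exact: (lie_derivedP _ _ derived_sub_C).
  apply: (subvP (addvSr _ _)).
  exact: triadon_bracket_center gt_triadon.
- by move=> x y xC yC; rewrite gdC // gtC // addr0.
Qed.
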